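(* Let $P$ be a finite poset, let $s \geqslant 3$, and let $T_1, \ldots, T_s$ be disjoint chains covering $P$ (that is, $P = T_1 \cup \cdots \cup T_s$ and the $T_j$ are pairwise disjoint). Assume that, for all $j, k$ with $1 \leqslant j, k \leqslant s$ and $j \neq k$, and for all $p \in T_j$, $q \in T_k$ such that $p < q$, we have $P = {\uparrow}p \cup {\downarrow}q$. Then there exist subsets $R_1, \ldots, R_n$ of $P$ such that $P = R_1 \oplus \cdots \oplus R_n$ and, for each $i = 1, \ldots, n$, either (1) $R_i \cap T_j = \emptyset$ for some $j \in \{1, \ldots, s\}$, or (2) $p \parallel q$ whenever $p \in R_i \cap T_j$, $q \in R_i \cap T_k$, and $j \neq k$ (with $j,k \in \{1,\ldots,s\}$).
   Context: A poset is a set with a reflexive, transitive, antisymmetric relation $\leqslant$. Elements $a, b$ are comparable if $a \leqslant b$ or $a \geqslant b$; otherwise they are incomparable, written $a \parallel b$. A chain in $P$ is a subset of $P$ any two of whose elements are comparable. For $p \in P$, ${\uparrow}p := \{ r \in P \mid p \leqslant r \}$ and ${\downarrow}p := \{ r \in P \mid r \leqslant p \}$. For subsets $R_1, \ldots, R_n$ of $P$, $P = R_1 \oplus \cdots \oplus R_n$ (ordinal sum) means that the $R_i$ are pairwise disjoint, $P = R_1 \cup \cdots \cup R_n$, each $R_i$ carries the order inherited from $P$, and $p < q$ whenever $p \in R_i$, $q \in R_{i'}$ with $i < i'$. *)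

(* Defs.v *)
From mathcomp Require Import all_boot all_order.

Set Implicit Arguments.
Unset Strict Implicit.
Unset Printing Implicit Defensive.

Local Open Scope order_scope.

Definition upset (d : Order.disp_t) (P : finPOrderType d) (p : P) : {set P} :=
  [set r | p <= r].

Definition downset (d : Order.disp_t) (P : finPOrderType d) (p : P) : {set P} :=
  [set r | r <= p].

(* As usual, the empty set counts as a chain. *)
Definition is_chain (d : Order.disp_t) (P : finPOrderType d) (A : {set P}) : Prop :=
  {in A &, forall a b : P, a >=< b}.

Definition pairwise_disjoint (T : finType) (n : nat) (F : 'I_n -> {set T}) : Prop :=
  forall i j : 'I_n, i != j -> [disjoint F i & F j].

(* P is the internal ordinal sum of R 0, ..., R (n - 1); the order on each
   summand is the one inherited from P, so it needs no separate clause.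
   The summands are allowed to be empty. *)
Definition is_ordinal_sum (d : Order.disp_t) (P : finPOrderType d) (n : nat)
    (R : 'I_n -> {set P}) : Prop :=
  [/\ pairwise_disjoint R,
      \bigcup_(i < n) R i = [set: P]
    & forall i i' : 'I_n, (i < i')%N ->
        forall p q : P, p \in R i -> q \in R i' -> p < q].

(* Main.v *)
Require Import Defs.
From mathcomp Require Import all_boot all_order.

Set Implicit Arguments.
Unset Strict Implicit.
Unset Printing Implicit Defensive.

Import Order.TTheory.

Local Open Scope order_scope.

(** The summands are the connected components of the incomparability graph of
    [P]. Two elements of different components are comparable, and moving one
    of them along an incomparability edge inside its component cannot reverse
    the comparison; so the components are linearly ordered, and [P] is their
    ordinal sum. The summand of [p] can be numbered by the count of the elements
    that lie below [p] outside its component ([lower_rank_eq],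
    [lower_rank_lt]).

    Write the partition into chains as a colouring. The hypothesis on [P] says
    that incomparability is transitive as long as the two end points have
    different colours ([incomp_trans]): if [x < z] have different colours,
    every [y] lies above [x] or below [z], hence is comparable to one of them.
    This has two consequences in a component that meets every chain. First,
    each of its elements has an incomparable element in every chain other than
    its own ([component_neighbour]). Second, since there is a third chain to
    pass through, two elements of one chain with a common neighbour in the
    incomparability graph have the same neighbours
    ([common_neighbour_twins]). Following a path that starts at [p], one
    therefore only meets neighbours of [p] and elements of the chain of [p]
    all of whose neighbours are neighbours of [p]; so [p] is incomparable to all elements of
    its component in the other chains ([component_multipartite]). *)

(** * Components of the incomparability graph *)

Definition incomp (d : Order.disp_t) (P : porderType d) : rel P :=
  fun x y => x >< y.

Lemma incomp_sym (d : Order.disp_t) (P : porderType d) :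
  symmetric (@incomp d P).
Proof. by move=> x y; rewrite /incomp comparable_sym. Qed.

Lemma connect_invariant (V : finType) (e : rel V) (Q : V -> Prop) (x y : V) :
  (forall u v, e u v -> Q u -> Q v) -> connect e x y -> Q x -> Q y.
Proof.
move=> stepQ /connectP[p + ->]; elim: p x => [|z p IHp] x //= /andP[exz pz] Qx.
exact: IHp pz (stepQ _ _ exz Qx).
Qed.

Section Components.

Variables (d : Order.disp_t) (P : finPOrderType d).
Implicit Types p q x : P.

Local Notation same_component := (connect (@incomp d P)).

Lemma component_sym : connect_sym (@incomp d P).
Proof. exact/sym_connect_sym/incomp_sym. Qed.

Lemma components_comparable p q : ~~ same_component p q -> p >=< q.
Proof. by apply: contraNT => pq; apply: connect1. Qed.

(** If [x < p], [p] and [q] are incomparable and [x] is comparable to [q], then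
    [x < q], as [q <= x] would give [q < p]. *)
Lemma lt_component x p q :
  ~~ same_component x p -> same_component p q -> x < p -> x < q.
Proof.
move=> xp pq ltxp.
pose outside_below u := ~~ same_component x u /\ x < u.
suff [] : outside_below q by [].
apply: connect_invariant pq (conj xp ltxp) => u v uv [xu ltxu].
have xv : ~~ same_component x v.
  apply: contra xu => /connect_trans; apply.
  by rewrite component_sym connect1.
split=> //; move: (components_comparable xv).
case: comparableP => // [ltvx|eqxv].
  by move: uv; rewrite /incomp comparable_sym lt_comparable // (lt_trans ltvx).
by move: xv; rewrite eqxv connect0.
Qed.

Definition lower_rank p : nat := #|[set x | ~~ same_component x p & x < p]|.

Lemma lower_rank_eq p q : same_component p q -> lower_rank p = lower_rank q.
Proof.
suff sub u v : same_component u v -> (lower_rank u <= lower_rank v)%N.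
  by move=> pq; apply/eqP; rewrite eqn_leq !sub // component_sym.
move=> uv; apply/subset_leq_card/subsetP => x; rewrite !inE => /andP[xu ltxu].
rewrite (lt_component xu uv ltxu) andbT; apply: contra xu => /connect_trans.
by apply; rewrite component_sym.
Qed.

Lemma lower_rank_lt p q :
  ~~ same_component p q -> p < q -> (lower_rank p < lower_rank q)%N.
Proof.
move=> pq ltpq; apply/proper_card/properP; split; last first.
  by exists p; rewrite !inE ?pq // connect0.
apply/subsetP => x; rewrite !inE => /andP[xp ltxp].
rewrite (lt_trans ltxp ltpq) andbT; apply/negP => xq.
have := lt_component pq; rewrite component_sym in xq => /(_ _ xq ltpq) ltpx.
by have := lt_trans ltpx ltxp; rewrite ltxx.
Qed.

Lemma lower_rank_same p q : lower_rank p = lower_rank q -> same_component p q.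
Proof.
move=> eqr; apply/negPn/negP => pq.
case: (comparableP p q) (components_comparable pq) => // [ltpq|ltqp|eqpq] _.
- by have := lower_rank_lt pq ltpq; rewrite eqr ltnn.
- rewrite component_sym in pq.
  by have := lower_rank_lt pq ltqp; rewrite eqr ltnn.
- by move: pq; rewrite eqpq connect0.
Qed.

Lemma lt_of_lower_rank p q : (lower_rank p < lower_rank q)%N -> p < q.
Proof.
move=> ltr; have pq : ~~ same_component p q.
  by apply/negP => /lower_rank_eq eqr; rewrite eqr ltnn in ltr.
case: (comparableP p q) (components_comparable pq) => // [ltqp|eqpq] _.
- rewrite component_sym in pq.
  by have := lower_rank_lt pq ltqp; rewrite ltnNge (ltnW ltr).
- by move: ltr; rewrite eqpq ltnn.
Qed.

(** The lower rank is an element of ['I_#|P|.+1], which leaves some of the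
    summands empty. *)
Lemma lower_rank_ordinal_sum :
  is_ordinal_sum (fun i : 'I_#|P|.+1 => [set p | lower_rank p == i]).
Proof.
split=> [i j neqij||i i' ltii' p q].
- rewrite -setI_eq0; apply/eqP/setP => p; rewrite !inE.
  apply/negP => /andP[/eqP eqi /eqP eqj].
  by move: neqij; rewrite -val_eqE /= -eqi -eqj eqxx.
- apply/setP => p; rewrite inE; apply/bigcupP.
  have ltp : (lower_rank p < #|P|.+1)%N by rewrite ltnS max_card.
  by exists (Ordinal ltp); rewrite // inE.
- rewrite !inE => /eqP eqp /eqP eqq.
  by apply: lt_of_lower_rank; rewrite eqp eqq.
Qed.

End Components.

(** * Components that meet three chains *)

Section ColouredComponents.

Variables (d : Order.disp_t) (P : finPOrderType d) (I : eqType) (c : P -> I).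
Implicit Types p q u v w x y z : P.

Hypothesis monochromatic_comparable : forall x y, c x = c y -> x >=< y.
Hypothesis above_or_below :
  forall p q, c p != c q -> p < q -> forall r, (p <= r) || (r <= q).

Local Notation same_component := (connect (@incomp d P)).

Lemma incomp_colour x y : x >< y -> c x != c y.
Proof. by apply: contra => /eqP /monochromatic_comparable. Qed.

Lemma incomp_trans y x z : c x != c z -> x >< y -> y >< z -> x >< z.
Proof.
move=> cxz xy yz; apply/negP => xz.
case: (comparableP x z) xz => // [ltxz|ltzx|eqxz] _.
- case/orP: (above_or_below cxz ltxz y) => [lexy|leyz].
  + by rewrite le_comparable in xy.
  + by rewrite le_comparable in yz.
- rewrite eq_sym in cxz; case/orP: (above_or_below cxz ltzx y) => [lezy|leyx].
  + by rewrite ge_comparable in yz.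
  + by rewrite ge_comparable in xy.
- by rewrite eqxz eqxx in cxz.
Qed.

(** Having the colour of [w], or a neighbour of that colour, is preserved along
    an edge from [x] to [y]: if [y] has another colour, then by [incomp_trans]
    a neighbour of [x] with the colour of [w] is also a neighbour of [y]. *)
Lemma component_neighbour w p :
  same_component w p -> c p != c w -> exists2 u, c u = c w & u >< p.
Proof.
move=> wp cpw.
pose near_colour x := c x = c w \/ exists2 u, c u = c w & u >< x.
suff [eqc|//] : near_colour p.
  by rewrite eqc eqxx in cpw.
apply: connect_invariant wp (or_introl erefl) => x y xy.
have [eqy _|neqy] := eqVneq (c y) (c w); first by left.
case=> [eqx|[u equ ux]]; right; first by exists x.
by exists u => //; apply: incomp_trans xy; rewrite // equ eq_sym.
Qed.

(** Neighbours of [q] whose colour is not that of [v] reach [p] through [v]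
    by [incomp_trans]. With [p] and [q] exchanged, the same argument makes [u] a
    second common neighbour, and the neighbours of [q] with the colour of [v]
    reach [p] through [u]. *)
Lemma common_neighbour_twins p q v u z :
  c p = c q -> p >< v -> v >< q -> u >< p -> c u != c v -> z >< q -> z >< p.
Proof.
move=> cpq pv vq up cuv zq.
have czp : c z != c p by rewrite cpq incomp_colour.
have vp : v >< p by rewrite comparable_sym.
have qv : q >< v by rewrite comparable_sym.
have [eqzv|neqzv] := eqVneq (c z) (c v); last first.
  exact: incomp_trans czp (incomp_trans neqzv zq qv) vp.
have uq : u >< q.
  apply: incomp_trans (incomp_trans cuv up pv) vq.
  by rewrite -cpq incomp_colour.
have qu : q >< u by rewrite comparable_sym.
have czu : c z != c u by rewrite eqzv eq_sym.
exact: incomp_trans czp (incomp_trans czu zq qu) up.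
Qed.

(** The path invariant must say more than that each vertex is a neighbour of
    [p] or has the colour of [p], as this is not preserved when the path leaves
    a vertex of the colour of [p]. *)
Lemma component_multipartite p q :
  (forall a b : I, exists w, [/\ same_component w p, c w != a & c w != b]) ->
  same_component p q -> c p != c q -> p >< q.
Proof.
move=> third pq cpq.
pose neighbour_or_twin x := x >< p \/ c x = c p /\ forall z, z >< x -> z >< p.
suff [|[eqc _]] : neighbour_or_twin q.
- by rewrite comparable_sym.
- by rewrite eqc eqxx in cpq.
apply: connect_invariant pq (or_intror (conj erefl (fun=> id))) => x y xy.
case=> [xp|[_ sub]]; last by left; apply: sub; rewrite comparable_sym.
have [eqy|neqy] := eqVneq (c y) (c p); last first.
  by left; apply: incomp_trans neqy _ xp; rewrite comparable_sym.
right; split=> // z; have [w [wp cwp cwx]] := third (c p) (c x).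
rewrite eq_sym in cwp; have [u equ up] := component_neighbour wp cwp.
apply: common_neighbour_twins xy up _ => //; last by rewrite equ.
by rewrite comparable_sym.
Qed.

End ColouredComponents.

Lemma exists_third (s : nat) (a b : 'I_s) :
  (3 <= s)%N -> exists m : 'I_s, (m != a) && (m != b).
Proof.
move=> hs; have : (0 < #|~: [set a; b]|)%N.
  have := cardsC [set a; b]; rewrite card_ord => eqs.
  rewrite -(ltn_add2l #|[set a; b]|) eqs addn0 cards2.
  by apply: leq_trans hs; case: (a != b).
by case/card_gt0P=> m; rewrite !inE negb_or; exists m.
Qed.

Theorem mainTheorem1 (d : Order.disp_t) (P : finPOrderType d) (s : nat)
    (hs : (3 <= s)%N) (T : 'I_s -> {set P})
    (Tchain : forall j : 'I_s, is_chain (T j))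
    (Tdisj : pairwise_disjoint T)
    (Tcover : \bigcup_(j < s) T j = [set: P])
    (Tupdown : forall j k : 'I_s, j != k ->
       forall p q : P, p \in T j -> q \in T k -> p < q ->
         [set: P] = upset p :|: downset q) :
  exists (n : nat) (R : 'I_n -> {set P}),
    is_ordinal_sum R /\
    forall i : 'I_n,
      (exists j : 'I_s, R i :&: T j = set0) \/
      (forall j k : 'I_s, j != k ->
         forall p q : P, p \in R i :&: T j -> q \in R i :&: T k -> p >< q).
Proof.
have [c Tc] : exists c : P -> 'I_s, forall p, p \in T (c p).
  apply: (@fin_all_exists P (fun=> 'I_s) (fun p j => p \in T j)) => p.
  by have := in_setT p; rewrite -Tcover => /bigcupP[j _ pTj]; exists j.
have cT p j : p \in T j -> c p = j.
  move=> pTj; apply/eqP; apply: contraTT pTj => /Tdisj /disjointFr.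
  by move=> ->.
have mono x y : c x = c y -> x >=< y.
  by move=> eqc; apply: (Tchain (c x)); rewrite // eqc.
have updown p q : c p != c q -> p < q -> forall r, (p <= r) || (r <= q).
  move=> cpq ltpq r; have := in_setT r.
  by rewrite (Tupdown _ _ cpq _ _ (Tc p) (Tc q) ltpq) !inE.
exists #|P|.+1, (fun i : 'I__ => [set p | lower_rank p == i]).
split=> [|i]; first exact: lower_rank_ordinal_sum.
case: (pickP (fun j : 'I_s => [set p | lower_rank p == i] :&: T j == set0)).
  by move=> j /eqP; left; exists j.
move=> meets; right=> j k neqjk p q.
rewrite !inE => /andP[/eqP rp /cT cp] /andP[/eqP rq /cT cq].
apply: (component_multipartite mono updown); last by rewrite cp cq.
- move=> a b; have [m /andP[ma mb]] := exists_third a b hs.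
  have /set0Pn[w] := negbT (meets m); rewrite !inE => /andP[/eqP rw /cT cw].
  by exists w; rewrite cw; split=> //; apply: lower_rank_same; rewrite rw rp.
- by apply: lower_rank_same; rewrite rp rq.
Qed.
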